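(* Let $\{u_i\}_{i\in\mathbb{N}}$ be an $(A,B)$-frame for a Hilbert space $H$, with analysis operator $T$ and Gram operator $G=TT^*$, and let $\mathbf{G}_k$ ($k\ge 1$) be the finite sections of $G$ (extended by zero to $\ell_2$). Assume that the frame has no spectral pollution in the gap $(0,A)$. Fix $\epsilon\in(0,A)$ and $x\in H$. Let $a=G^+Tx\in\ell_2$, and let $$a^{(k)}_\epsilon=\mathbf{G}_{k,\epsilon}^+\,(Tx)_k ,$$ where $\mathbf{G}_{k,\epsilon}^+ = h_\epsilon(\mathbf{G}_k)$ is obtained by applying the spectral map $h_\epsilon(\lambda)=\lambda^{-1}\mathbb{I}_{\{\lambda>\epsilon\}}$ (equal to $1/\lambda$ if $\lambda>\epsilon$ and $0$ otherwise) to $\mathbf{G}_k$. Then $$\lim_{k\to\infty}\|a^{(k)}_\epsilon-a\|_{\ell_2}=0 .$$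
   Context: A sequence $\{u_i\}_{i\in\mathbb{N}}$ in a Hilbert space $H$ is an $(A,B)$-frame if $0<A\le B<\infty$ and $A\|x\|^2\le\sum_{i=1}^\infty|\langle x,u_i\rangle|^2\le B\|x\|^2$ for all $x\in H$. Its analysis operator is the bounded map $T:H\to\ell_2$, $Tx=(\langle x,u_i\rangle)_{i\in\mathbb{N}}$; the adjoint (synthesis operator) is $T^*a=\sum_i a_iu_i$. The Gram operator is $G=TT^*:\ell_2\to\ell_2$, which is bounded, self-adjoint and positive. For a bounded self-adjoint operator $S$ on a Hilbert space $H'$, the Moore-Penrose pseudo-inverse $S^+:\mathrm{ran}(S)\oplus\ker(S)\to H'$ is $(S|_{\ker(S)^\perp})^{-1}$ on $\mathrm{ran}(S)$ and $0$ on $\ker(S)$. For the Gram operator of a frame, $G^+$ is bounded and everywhere defined. The $k$-th finite section $\mathbf{G}_k$ is the $k\times k$ upper-left block of $G$, i.e. the Gram matrix of $u_1,\dots,u_k$; extended by zero to $\ell_2$ it is $P_kGP_k$, where $P_k$ is the orthogonal projection of $\ell_2$ onto the first $k$ coordinates. The truncated vector is $(Tx)_k=P_kTx=(\langle x,u_1\rangle,\dots,\langle x,u_k\rangle)$, regarded as an element of $\ell_2$ via extension by zero. The frame has no spectral pollution in the gap if the eigenvalues of the matrices $\mathbf{G}_k$ have no limit points in $(0,A)$ as $k\to\infty$: there is no $\lambda\in(0,A)$ for which there exist $k_1<k_2<\cdots$ and eigenvalues $\lambda_j$ of $\mathbf{G}_{k_j}$ with $\lambda_j\to\lambda$. *)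

(* Defs.v *)
From HB Require Import structures.
From mathcomp Require Import all_boot all_order all_algebra sesquilinear.
From mathcomp Require Import complex.
From mathcomp Require Import all_classical all_reals all_analysis.

Set Implicit Arguments.
Unset Strict Implicit.
Unset Printing Implicit Defensive.

Import Order.TTheory GRing.Theory Num.Theory.
Import numFieldNormedType.Exports.

Local Open Scope classical_set_scope.
Local Open Scope complex_scope.
Local Open Scope ring_scope.

(* Hilbert spaces are over the reals or the complex numbers: both cases are    *)
(* covered by letting the scalar field be [base_field R k].                   *)
Variant scalar_kind := RealScalars | ComplexScalars.

Definition base_field (R : realType) (k : scalar_kind) : numFieldType :=
  match k with RealScalars => R | ComplexScalars => R[i] end.

Definition sconj (R : realType) (k : scalar_kind) :
    base_field R k -> base_field R k :=
  match k with RealScalars => id | ComplexScalars => @conjc R end.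

Definition of_real (R : realType) (k : scalar_kind) : R -> base_field R k :=
  match k with RealScalars => id | ComplexScalars => real_complex R end.

Definition sre (R : realType) (k : scalar_kind) : base_field R k -> R :=
  match k with RealScalars => id | ComplexScalars => @complex.Re R end.

(* MathComp norms take their values in the scalar field (in [R[i]] in the      *)
(* complex case); [rnorm] is the same norm as an element of [R].              *)
Definition rnorm (R : realType) (k : scalar_kind)
  (V : normedZmodType (base_field R k)) (v : V) : R := sre `|v|.

Section SquareSummableSequences.
Context (R : realType) (k : scalar_kind).
Local Notation K := (base_field R k).
Implicit Types a b w z : nat -> K.

Definition ell2_norm a : \bar R :=
  ((\sum_(0 <= i <oo) ((rnorm (a i)) ^+ 2)%:E) `^ 2^-1)%E.

Definition ell2 a : Prop := (ell2_norm a < +oo)%E.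

Definition ell2_dot a b : K := limn (series (fun i => a i * sconj (b i))).

(* [is_pinv S b z]: [b] is in ran S + ker S, with ker S-component [w] and      *)
(* ran S-component [S z], where [z] is orthogonal to ker S.                    *)
Definition is_pinv (S : (nat -> K) -> (nat -> K)) b z : Prop :=
  [/\ ell2 z,
      forall w, ell2 w -> S w = cst 0 -> ell2_dot z w = 0 &
      exists w, [/\ ell2 w, S w = cst 0 & b = (fun i => S z i + w i)]].

(* The value is irrelevant outside the domain ran S + ker S.                  *)
Definition pinv (S : (nat -> K) -> (nat -> K)) b : nat -> K :=
  xget (cst 0) [set z | is_pinv S b z].

Definition extend0 (n : nat) (v : 'cV[K]_n) : nat -> K :=
  fun i => if insub i is Some j then v j 0 else 0.

End SquareSummableSequences.

Section MatrixSpectralMap.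
Context (R : realType) (k : scalar_kind).
Local Notation K := (base_field R k).

(* MathComp matrices act on row vectors: [v *m orth_proj U] is the orthogonal  *)
(* projection of [v] on the row space of [U], the complement being             *)
(* { w | w *m U^* = 0 }.                                                      *)
Definition orth_proj (n : nat) (U : 'M[K]_n) : 'M[K]_n :=
  proj_mx <<U>>%MS (kermx (map_mx (@sconj R k) U^T)).

(* h(M) = sum over the (finite, real) spectrum of h(l) P_l, for M Hermitian.   *)
(* P_l is a self-adjoint matrix commuting with M, so that the use of row       *)
(* eigenspaces gives the same matrix h(M) as that of column eigenspaces.       *)
Definition spectral_map (h : R -> R) (n : nat) (M : 'M[K]_n) : 'M[K]_n :=
  \sum_(l \in [set l : R | eigenvalue M (of_real k l)])
    of_real k (h l) *: orth_proj (eigenspace M (of_real k l)).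

End MatrixSpectralMap.

Definition threshold_inv (R : realType) (eps l : R) : R :=
  if eps < l then l^-1 else 0.

Section Frames.
Context (R : realType) (k : scalar_kind).
Local Notation K := (base_field R k).
Context (H : completeNormedModType K) (dot : {dot H for @sconj R k}).
Implicit Types (A B : R) (u : nat -> H) (x : H).

Definition is_frame A B u : Prop :=
  [/\ 0 < A, A <= B &
      forall x,
        ((A * rnorm x ^+ 2)%:E <= \sum_(0 <= i <oo) (rnorm (dot x (u i)) ^+ 2)%:E
                               <= (B * rnorm x ^+ 2)%:E)%E].

Definition analysis_op u x : nat -> K := fun i => dot x (u i).

Definition synthesis_op u (a : nat -> K) : H := limn (series (fun i => a i *: u i)).

Definition gram_op u (a : nat -> K) : nat -> K := analysis_op u (synthesis_op u a).

(* (i, j) entry <u_j, u_i>, so that [gram_section u n *m c] is P_n G c.        *)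
Definition gram_section u (n : nat) : 'M[K]_n := \matrix_(i, j) dot (u j) (u i).

Definition no_spectral_pollution A u : Prop :=
  ~ exists (l : R) (n_ : nat -> nat) (l_ : nat -> R),
      [/\ 0 < l < A,
          {homo n_ : i j / (i < j)%N},
          forall j, eigenvalue (gram_section u (n_ j)) (of_real k (l_ j)) &
          l_ @ \oo --> l].

Definition canonical_coef u x : nat -> K := pinv (gram_op u) (analysis_op u x).

Definition section_coef (eps : R) u x (n : nat) : nat -> K :=
  extend0 (spectral_map (threshold_inv eps) (gram_section u n)
             *m \col_(i < n) analysis_op u x i).

End Frames.

(* Main.v *)
(** The frame operator [S = T^* T] is invertible: write [x = S y] and [y = S z].
    Then [a = T y] is the canonical coefficient sequence, [x = sum a_j u_j] and,
    with [b = T z], [y = sum b_j u_j].  Put [M = G_n], [h = h_eps], let [a_n], [b_n]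
    be the truncations of [a], [b], and let [e], [e'] be the vectors
    [<x - s_n, u_i>], [<y - s'_n, u_i>] (i < n), where [s_n], [s'_n] are the
    partial sums of the two expansions; so [(T x)_n = M a_n + e] and
    [a_n = M b_n + e'].  Hence
      [h(M) (T x)_n - a_n = h(M) e - (1 - h(M) M) M b_n - (1 - h(M) M) e'].
    The norms of [e], [e'] tend to 0 while [|h(M)| <= 1/eps] and
    [|1 - h(M) M| <= 1]; and [|(1 - h(M) M) M| <= delta] as soon as [M] has no
    eigenvalue in [[delta, eps]], which holds for large [n] by the gap hypothesis. *)

Require Import Defs.
From HB Require Import structures.
From mathcomp Require Import all_boot all_order all_algebra sesquilinear.
From mathcomp Require Import complex finmap.
From mathcomp Require Import all_classical all_reals all_analysis.
From mathcomp Require Import ring lra.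

Import Order.TTheory GRing.Theory Num.Theory.
Import numFieldNormedType.Exports.

Local Open Scope classical_set_scope.
Local Open Scope ring_scope.

Set Implicit Arguments.
Unset Strict Implicit.
Unset Printing Implicit Defensive.

(** * Real and complex scalars treated uniformly *)

Section BaseField.
Context (R : realType) (k : scalar_kind).
Local Notation K := (base_field R k).
Implicit Types z w : K.

Lemma sconj_is_zmod_morphism : zmod_morphism (@sconj R k).
Proof. by case: k => // z w; rewrite /sconj rmorphB. Qed.

Lemma sconj_is_monoid_morphism : monoid_morphism (@sconj R k).
Proof. by case: k => //; split=> [|z w]; rewrite /sconj ?rmorphM ?rmorph1. Qed.

HB.instance Definition _ :=
  GRing.isZmodMorphism.Build K K (@sconj R k) sconj_is_zmod_morphism.
HB.instance Definition _ :=
  GRing.isMonoidMorphism.Build K K (@sconj R k) sconj_is_monoid_morphism.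

Lemma of_real_is_zmod_morphism : zmod_morphism (@of_real R k).
Proof. by case: k => // z w; rewrite /of_real rmorphB. Qed.

Lemma of_real_is_monoid_morphism : monoid_morphism (@of_real R k).
Proof.
by case: k => //; split=> [|z w]; rewrite /of_real ?rmorphM ?rmorph1.
Qed.

HB.instance Definition _ :=
  GRing.isZmodMorphism.Build R K (@of_real R k) of_real_is_zmod_morphism.
HB.instance Definition _ :=
  GRing.isMonoidMorphism.Build R K (@of_real R k) of_real_is_monoid_morphism.

Lemma sre_is_zmod_morphism : zmod_morphism (@sre R k).
Proof. by case: k => // -[a b] [c d]. Qed.

HB.instance Definition _ :=
  GRing.isZmodMorphism.Build K R (@sre R k) sre_is_zmod_morphism.

Lemma sconjK : involutive (@sconj R k).
Proof. by rewrite /sconj; case: k => // z; rewrite conjcK. Qed.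

Lemma sconj_of_real (r : R) : sconj (of_real k r) = of_real k r.
Proof. by rewrite /sconj /of_real; case: k => //=; rewrite oppr0. Qed.

Lemma of_realK : cancel (@of_real R k) (@sre R k).
Proof. by rewrite /of_real /sre; case: k. Qed.

Lemma ler_of_real (r s : R) : (of_real k r <= of_real k s) = (r <= s).
Proof. by rewrite /of_real; case: k => //; rewrite lecR. Qed.

Lemma ltr_of_real (r s : R) : (of_real k r < of_real k s) = (r < s).
Proof. by rewrite /of_real; case: k => //; rewrite ltcR. Qed.

Lemma sre_of_realM (r : R) z : sre (of_real k r * z) = r * sre z.
Proof.
rewrite /of_real /sre; case: k z => //= -[a b] /=.
by rewrite mul0r subr0.
Qed.

Lemma sre_conj z : sre (sconj z) = sre z.
Proof. by rewrite /sconj /sre; case: k z => //= -[a b]. Qed.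

Lemma of_real_ge0 z : 0 <= z -> of_real k (sre z) = z.
Proof.
rewrite /of_real /sre; case: k z => //= -[a b].
by rewrite lecE /= => /andP[/eqP -> _].
Qed.

Lemma of_real_rnorm (V : normedZmodType K) (v : V) : of_real k (rnorm v) = `|v|.
Proof. exact: of_real_ge0. Qed.

Lemma sre_le_rnorm z : sre z <= rnorm z.
Proof.
rewrite /rnorm /sre; case: k z => /=; first exact: ler_norm.
move=> z; have := normc_ge_Re z; rewrite lecE => /andP[_].
by apply: le_trans; rewrite /= ler_norm.
Qed.

Lemma mul_sconj z : z * sconj z = of_real k (rnorm z ^+ 2).
Proof.
rewrite rmorphXn /= of_real_rnorm /sconj; case: k z => /= z.
  by rewrite -expr2 real_normK// num_real.
by rewrite sqr_normc.
Qed.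

Lemma sconj_fixed z : sconj z = z -> of_real k (sre z) = z.
Proof.
rewrite /sconj /of_real /sre; case: k z => //= -[a b] [] /eqP.
rewrite eq_sym -addr_eq0 -mulr2n mulrn_eq0 /= => /eqP ->.
by [].
Qed.

Section Norm.
Variable V : normedZmodType K.

Lemma rnorm_ge0 (v : V) : 0 <= rnorm v.
Proof. by rewrite -ler_of_real rmorph0 of_real_rnorm. Qed.

Lemma rnormD (v v2 : V) : rnorm (v + v2) <= rnorm v + rnorm v2.
Proof. by rewrite -ler_of_real rmorphD /= !of_real_rnorm ler_normD. Qed.

Lemma rnormN (v : V) : rnorm (- v) = rnorm v.
Proof. by rewrite /rnorm normrN. Qed.

Lemma rnormB (v v2 : V) : rnorm (v - v2) = rnorm (v2 - v).
Proof. by rewrite /rnorm distrC. Qed.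

Lemma rnorm0 : rnorm (0 : V) = 0.
Proof. by rewrite /rnorm normr0 raddf0. Qed.

Lemma rnorm0_eq0 (v : V) : rnorm v = 0 -> v = 0.
Proof. by move=> v0; apply: normr0_eq0; rewrite -of_real_rnorm v0 rmorph0. Qed.

End Norm.

Lemma rnormM z w : rnorm (z * w) = rnorm z * rnorm w.
Proof.
apply: (can_inj of_realK).
by rewrite rmorphM /= !of_real_rnorm normrM.
Qed.

Lemma rnorm_sconj z : rnorm (sconj z) = rnorm z.
Proof.
apply/eqP; rewrite -(@eqrXn2 _ 2) ?rnorm_ge0//; apply/eqP.
by apply: (can_inj of_realK); rewrite -!mul_sconj sconjK mulrC.
Qed.

Lemma rnorm_of_real (r : R) : rnorm (of_real k r) = `|r|.
Proof.
rewrite -(@sqr_sqrtr _ `|r|)//; apply/eqP.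
by rewrite sqr_sqrtr// -(@eqrXn2 _ 2) ?rnorm_ge0// -(inj_eq (can_inj of_realK))
  -mul_sconj sconj_of_real -rmorphM real_normK ?num_real.
Qed.

End BaseField.

(** * Convergence expressed through real-valued norms *)

Section Convergence.
Context (R : realType) (k : scalar_kind) (V : normedModType (base_field R k)).
Implicit Types (v : nat -> V) (l : V).

Lemma cvg_rnorm v l :
  (v @ \oo --> l) <-> ((fun n => rnorm (v n - l)) @ \oo --> 0).
Proof.
split => [vl|vl].
  apply/cvgrPdist_lt => e e0.
  have := (cvgrPdist_lt v l).1 vl (of_real k e).
  rewrite -(rmorph0 (@of_real R k)) ltr_of_real => /(_ _ e0).
  apply: filterS => n; rewrite -of_real_rnorm ltr_of_real rnormB.
  by rewrite sub0r normrN ger0_norm ?rnorm_ge0.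
apply/cvgrPdist_lt => e e0.
have ee : of_real k (sre e) = e by apply: of_real_ge0; exact: ltW.
have e1 : 0 < sre e by rewrite -(ltr_of_real k) rmorph0 ee.
have {vl} /(_ _ _ e1) := (cvgrPdist_lt _ _).1 vl.
apply: filterS => n; rewrite sub0r normrN ger0_norm ?rnorm_ge0//.
by rewrite rnormB -(ltr_of_real k) ee of_real_rnorm.
Qed.

Lemma rnorm_lim_le v l (C : R) :
  v @ \oo --> l -> (forall n, rnorm (v n) <= C) -> rnorm l <= C.
Proof.
move=> /cvg_rnorm vl vC; apply/ler_addgt0Pr => e e0.
have [N _ /(_ N (leqnn N)) vN] := cvgr_le 0 vl e e0.
rewrite -(subrK (v N) l) addrC (le_trans (rnormD _ _))// lerD//.
by rewrite rnormB.
Qed.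

End Convergence.

Lemma cvg_of_cauchy (R : realType) (k : scalar_kind)
    (V : completeNormedModType (base_field R k)) (v : nat -> V) :
  (forall e : R, 0 < e -> exists N, forall m, (N <= m)%N ->
     rnorm (v m - v N) <= e) ->
  exists l : V, v @ \oo --> l.
Proof.
move=> vC.
suff vl : cvgn v by exists (limn v).
apply/cauchy_cvgP/cauchy_exP => e e0.
have ee : of_real k (sre e) = e by apply: of_real_ge0; exact: ltW.
have e1 : 0 < sre e by rewrite -(ltr_of_real k) rmorph0 ee.
have [|N NP] := vC (sre e / 2); first by rewrite divr_gt0.
exists (v N); exists N => // m /= Nm.
rewrite -ball_normE /= -of_real_rnorm -ee ltr_of_real rnormB.
by rewrite (le_lt_trans (NP m Nm))// ltr_pdivrMr// ltr_pMr// ltr1n.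
Qed.

(** * Adjoint matrices and orthogonal projections *)

Section Adjoint.
Context (R : realType) (k : scalar_kind).
Local Notation K := (base_field R k).

Definition adjmx m n (X : 'M[K]_(m, n)) : 'M[K]_(n, m) :=
  map_mx (@sconj R k) X^T.

Lemma adjmxE m n (X : 'M[K]_(m, n)) i j : adjmx X i j = sconj (X j i).
Proof. by rewrite !mxE. Qed.

Lemma adjmxK m n (X : 'M[K]_(m, n)) : adjmx (adjmx X) = X.
Proof. by apply/matrixP => i j; rewrite !mxE sconjK. Qed.

Lemma adjmxM m n p (X : 'M[K]_(m, n)) (Y : 'M[K]_(n, p)) :
  adjmx (X *m Y) = adjmx Y *m adjmx X.
Proof. by rewrite /adjmx trmx_mul map_mxM. Qed.

Lemma adjmxZ m n (r : R) (X : 'M[K]_(m, n)) :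
  adjmx (of_real k r *: X) = of_real k r *: adjmx X.
Proof. by apply/matrixP => i j; rewrite !mxE rmorphM /= sconj_of_real. Qed.

Lemma mulmx_adj_diag m n (X : 'M[K]_(m, n)) i :
  (X *m adjmx X) i i = of_real k (\sum_j rnorm (X i j) ^+ 2).
Proof.
rewrite mxE rmorph_sum; apply: eq_bigr => j _.
by rewrite adjmxE mul_sconj.
Qed.

Lemma mulmx_adj_eq0 m n (X : 'M[K]_(m, n)) : X *m adjmx X = 0 -> X = 0.
Proof.
move=> X0; apply/matrixP => i j; rewrite mxE; apply: rnorm0_eq0.
have : \sum_j rnorm (X i j) ^+ 2 = 0.
  by apply: (can_inj (@of_realK R k)); rewrite -mulmx_adj_diag X0 mxE rmorph0.
move/eqP; rewrite psumr_eq0 => [/allP/(_ j)|? _]; last exact: sqr_ge0.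
by rewrite mem_index_enum sqrf_eq0 => /(_ isT)/eqP.
Qed.

Definition sqnorm n (w : 'cV[K]_n) : R := \sum_i rnorm (w i 0) ^+ 2.

Lemma sqnormE n (w : 'cV[K]_n) : of_real k (sqnorm w) = (adjmx w *m w) 0 0.
Proof.
rewrite -{3}(adjmxK w) mulmx_adj_diag; congr of_real.
by apply: eq_bigr => i _; rewrite adjmxE rnorm_sconj.
Qed.

Lemma sqnorm_ge0 n (w : 'cV[K]_n) : 0 <= sqnorm w.
Proof. by apply: sumr_ge0 => i _; exact: sqr_ge0. Qed.

Section OrthogonalProjection.
Variables (n : nat) (U : 'M[K]_n).

(** Rows [C = D *m U] that are orthogonal to [U] satisfy [C *m adjmx C = C *m adjmx U *m adjmx D =
    0]. *)
Lemma orth_cap : (<<U>> :&: kermx (adjmx U))%MS = 0.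
Proof.
set C := (_ :&: _)%MS; apply: mulmx_adj_eq0.
have /submxP[D CU] : (C <= U)%MS by rewrite -(genmxE U) capmxSl.
have CK : C *m adjmx U = 0 by apply/sub_kermxP; exact: capmxSr.
by rewrite {2}CU adjmxM mulmxA CK mul0mx.
Qed.

(** Dimension count: the complement has rank [n - \rank U], since conjugation and transposition
    preserve the rank, and it meets [U] trivially. *)
Lemma orth_full m (X : 'M[K]_(m, n)) : (X <= <<U>> + kermx (adjmx U))%MS.
Proof.
apply: submx_full; rewrite /row_full mxrank_disjoint_sum ?orth_cap//.
rewrite mxrank_gen mxrank_ker mxrank_map mxrank_tr subnKC//.
exact: rank_leq_row.
Qed.

Lemma orth_proj_sub : (orth_proj U <= U)%MS.
Proof. by rewrite -[orth_proj U]mul1mx (submx_trans (proj_mx_sub _ _ _))// genmxE. Qed.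

Lemma orth_proj_id m (X : 'M[K]_(m, n)) : (X <= U)%MS -> X *m orth_proj U = X.
Proof. by move=> XU; rewrite proj_mx_id ?orth_cap// genmxE. Qed.

Lemma orth_proj_idem : orth_proj U *m orth_proj U = orth_proj U.
Proof. exact/orth_proj_id/orth_proj_sub. Qed.

Lemma orth_proj_compl : (1%:M - orth_proj U) *m adjmx U = 0.
Proof.
apply/sub_kermxP; rewrite -[X in 1%:M - X]mul1mx.
exact/proj_mx_compl_sub/orth_full.
Qed.

(** Writing [P = D *m U], orthogonality of the complement gives [(1 - P) *m adjmx P = 0], so
    [adjmx P = P *m adjmx P], which is self-adjoint. *)
Lemma orth_proj_adj : adjmx (orth_proj U) = orth_proj U.
Proof.
have [D PD] := submxP orth_proj_sub.
have PP : orth_proj U *m adjmx (orth_proj U) = adjmx (orth_proj U).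
  apply/eqP; rewrite eq_sym -subr_eq0 -[X in X - _]mul1mx -mulmxBl; apply/eqP.
  by rewrite {2}PD adjmxM mulmxA orth_proj_compl mul0mx.
by rewrite -[RHS]adjmxK -[in RHS]PP adjmxM adjmxK PP.
Qed.

End OrthogonalProjection.
End Adjoint.

(** * Spectral theory of Hermitian matrices over either field *)

Definition to_complex (R : realType) (k : scalar_kind) :
    base_field R k -> base_field R ComplexScalars :=
  match k with RealScalars => real_complex R | ComplexScalars => id end.

Section ToComplex.
Context (R : realType) (k : scalar_kind).
Local Notation K := (base_field R k).

Lemma to_complex_is_zmod_morphism : zmod_morphism (@to_complex R k).
Proof. by case: k => // z w; rewrite /to_complex rmorphB. Qed.

Lemma to_complex_is_monoid_morphism : monoid_morphism (@to_complex R k).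
Proof.
by case: k => //; split=> [|z w]; rewrite /to_complex ?rmorphM ?rmorph1.
Qed.

HB.instance Definition _ := GRing.isZmodMorphism.Build K
  (base_field R ComplexScalars) (@to_complex R k) to_complex_is_zmod_morphism.
HB.instance Definition _ := GRing.isMonoidMorphism.Build K
  (base_field R ComplexScalars) (@to_complex R k) to_complex_is_monoid_morphism.

Lemma to_complex_of_real (r : R) :
  to_complex (of_real k r) = of_real ComplexScalars r.
Proof. by rewrite /to_complex /of_real; case: k. Qed.

Lemma to_complex_sconj (z : K) : to_complex (sconj z) = sconj (to_complex z).
Proof.
by rewrite /to_complex /sconj; case: k z => //= z; rewrite oppr0.
Qed.

Lemma map_adjmx_to_complex m n (X : 'M[K]_(m, n)) :
  map_mx (@to_complex R k) (adjmx X) = adjmx (map_mx (@to_complex R k) X).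
Proof. by apply/matrixP => i j; rewrite !mxE to_complex_sconj. Qed.

End ToComplex.

(** [v *m M *m adjmx v = z *: (v *m adjmx v)] is self-adjoint, and [v *m adjmx v] is a nonzero real
    that can be cancelled. *)
Lemma herm_eigenvalue_real (R : realType) (k : scalar_kind) n
    (M : 'M[base_field R k]_n) (z : base_field R k) :
  adjmx M = M -> eigenvalue M z -> sconj z = z.
Proof.
move=> M_herm /eigenvalueP[v vM v0].
have vMv : v *m M *m adjmx v = z *: (v *m adjmx v) by rewrite vM scalemxAl.
have E : adjmx (v *m M *m adjmx v) = v *m M *m adjmx v.
  by rewrite !adjmxM adjmxK M_herm mulmxA.
have /matrixP/(_ 0 0) := E; rewrite vMv adjmxE !mxE rmorphM /=.
have := mulmx_adj_diag v 0; rewrite mxE => ->; rewrite sconj_of_real.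
apply: mulIf; apply: contra_neq v0 => s0; apply: mulmx_adj_eq0.
by apply/matrixP => i j; rewrite !ord1 mulmx_adj_diag s0 mxE.
Qed.

Section HermitianSpectrum.
Context (R : realType) (k : scalar_kind).
Local Notation K := (base_field R k).

(* The characteristic polynomial of the restriction to [V] has a root in        *)
(* [R[i]], real since [M] is Hermitian: this serves both scalar fields.        *)
Lemma herm_stable_eigenspace n (M V : 'M[K]_n) :
  adjmx M = M -> V != 0 -> (V *m M <= V)%MS ->
  exists l : R, (V :&: eigenspace M (of_real k l))%MS != 0.
Proof.
move=> M_herm V0 MV.
pose tc := @to_complex R k.
pose rb := row_base V; pose N := complex.restrict V M.
have rbM : rb *m M = N *m rb by rewrite /N /complex.restrict mulmxKpV ?stable_row_base.
have [z zN] : exists z, eigenvalue (map_mx tc N) z.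
  suff /(@closed_rootP R[i])[z z_root] : size (char_poly (map_mx tc N)) != 1%N.
    by exists z; rewrite eigenvalue_root_char.
  by rewrite size_char_poly eqSS mxrank_eq0.
(* An eigenvector of the restriction, pushed through the row basis, is one of [M]; hence [z] is
   real. *)
have zM : eigenvalue (map_mx tc M) z.
  have /eigenvalueP[v vN v0] := zN.
  apply/eigenvalueP; exists (v *m map_mx tc rb).
    by rewrite -mulmxA -map_mxM rbM map_mxM mulmxA vN scalemxAl.
  by rewrite mul_mx_rowfree_eq0 ?row_free_map ?row_base_free.
have zR : to_complex (of_real k (sre z)) = z.
  rewrite to_complex_of_real; apply: sconj_fixed.
  by apply: herm_eigenvalue_real zM; rewrite -map_adjmx_to_complex M_herm.
exists (sre z).
(* A real root of the complexified characteristic polynomial is already a root over [K], so an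
   eigenvector exists over [K]. *)
have /eigenvalueP[v /eigenspaceP vN v0] : eigenvalue N (of_real k (sre z)).
  move: zN; rewrite -{1}zR !eigenvalue_root_char -map_char_poly.
  by rewrite fmorph_root.
move: vN; rewrite eigenspace_restrict// => vM.
apply: contra_neq v0 => VE0.
apply/eqP; rewrite -(mul_mx_rowfree_eq0 _ (row_base_free V)) -submx0 -VE0.
by rewrite sub_capmx vM andbT (submx_trans (submxMl _ _))// eq_row_base.
Qed.

Variables (n : nat) (M : 'M[K]_n).
Hypothesis M_herm : adjmx M = M.

Let spec := fset_set [set l : R | eigenvalue M (of_real k l)].

Lemma finite_spectrum : finite_set [set l : R | eigenvalue M (of_real k l)].
Proof.
apply: contrapT => /(infinite_set_fset n.+1)[B BS nB].
have := @max_poly_roots _ (char_poly M) (map (@of_real R k) (B)).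
rewrite monic_neq0 ?char_poly_monic// size_char_poly size_map => /(_ isT).
rewrite map_inj_uniq ?fset_uniq; last exact: can_inj (@of_realK R k).
suff -> : all (root (char_poly M)) (map (@of_real R k) (B)).
  by move=> /(_ isT isT); rewrite ltnS leqNgt nB.
by apply/allP => _ /mapP[l /BS lM ->]; rewrite -eigenvalue_root_char.
Qed.

Local Notation E l := (eigenspace M (of_real k (val l))).
Local Notation P l := (orth_proj (E l)).

Lemma mem_spectrum (l : R) : (l \in spec) = eigenvalue M (of_real k l).
Proof.
by rewrite in_fset_set ?inE; [apply/asboolP/idP|exact: finite_spectrum].
Qed.

Lemma spectral_mapE (h : R -> R) :
  spectral_map h M = \sum_(l : spec) of_real k (h (val l)) *: P l.
Proof.
by rewrite /spectral_map fsbig_finite ?big_seq_fsetE//; exact: finite_spectrum.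
Qed.

(** The orthogonal complement of the sum [W] of the eigenspaces is stable under the Hermitian [M].
    Were it nonzero, it would contain an eigenvector, which also lies in [W]: a contradiction. *)
Lemma sum_eigenspaces_full m (X : 'M[K]_(m, n)) : (X <= \sum_(l : spec) E l)%MS.
Proof.
set W := (\sum_(l : spec) E l)%MS.
suff V0 : kermx (adjmx W) = 0.
  by have := orth_full W X; rewrite V0 addsmx0_id genmxE.
apply/eqP/negPn/negP => V0.
have MW : (W *m M <= W)%MS.
  rewrite sumsmxMr_gen; apply/sumsmx_subP => l _; rewrite genmxE.
  have /eigenspaceP -> : (E l <= E l)%MS by [].
  by rewrite scalemx_sub// (sumsmx_sup l).
have [|l] := herm_stable_eigenspace M_herm V0.
  apply/sub_kermxP; have [D WD] := submxP MW.
  by rewrite -M_herm -mulmxA -adjmxM WD adjmxM mulmxA mulmx_ker mul0mx.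
apply/negP/negPn; have [lS|lS] := boolP (l \in spec).
  rewrite -submx0 -(orth_cap W) capmxC capmxS// genmxE.
  exact: (sumsmx_sup (FSetSub lS)).
move: lS; rewrite mem_spectrum negbK => /eqP E0.
by rewrite -submx0 -E0 capmxSr.
Qed.

Lemma mul_orth_proj_eigenspace (l : spec) : P l *m M = of_real k (val l) *: P l.
Proof. by apply/eigenspaceP; exact: orth_proj_sub. Qed.

(** Evaluating [P l *m M *m P m] from either side gives both [l] and [m] times [P l *m P m]. *)
Lemma mul_orth_proj_neq (l m : spec) : l != m -> P l *m P m = 0.
Proof.
move=> lm.
have mP : M *m P m = of_real k (val m) *: P m.
  have := congr1 (@adjmx R k n n) (mul_orth_proj_eigenspace m).
  by rewrite adjmxM adjmxZ M_herm orth_proj_adj.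
have lmE : (of_real k (val l) - of_real k (val m)) *: (P l *m P m) = 0.
  have lP : of_real k (val l) *: (P l *m P m) = P l *m M *m P m.
    by rewrite mul_orth_proj_eigenspace scalemxAl.
  by rewrite scalerBl lP -mulmxA mP -scalemxAr subrr.
apply/eqP; move/eqP: lmE; rewrite scaler_eq0 subr_eq0 => /orP[/eqP|//].
by move/(can_inj (@of_realK R k))/val_inj/eqP; rewrite (negPf lm).
Qed.

(** Each eigenspace is fixed by its own projection and killed by the others, and the eigenspaces
    span the whole space. *)
Lemma sum_orth_proj : \sum_(l : spec) P l = 1%:M.
Proof.
apply/eqP; rewrite -subr_eq0 -[X in X == 0]mul1mx; apply/eqP/sub_kermxP.
apply: submx_trans (sum_eigenspaces_full 1%:M) _; apply/sumsmx_subP => l _.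
apply/sub_kermxP; rewrite mulmxBr mulmx1 mulmx_sumr (bigD1 l)//= big1 ?addr0.
  by rewrite orth_proj_id ?subrr.
move=> m ml.
by rewrite -{1}(orth_proj_id (submx_refl (E l))) -mulmxA mul_orth_proj_neq
  1?eq_sym// mulmx0.
Qed.

Lemma spectral_mapM (h g : R -> R) :
  spectral_map h M *m spectral_map g M = spectral_map (fun l => h l * g l) M.
Proof.
rewrite !spectral_mapE mulmx_suml; apply: eq_bigr => l _.
rewrite mulmx_sumr (bigD1 l)//= big1 ?addr0 => [|m ml].
  by rewrite -scalemxAl -scalemxAr orth_proj_idem scalerA -rmorphM.
by rewrite -scalemxAl -scalemxAr mul_orth_proj_neq 1?eq_sym// !scaler0.
Qed.

Lemma spectral_map_1 : spectral_map (fun=> 1) M = 1%:M.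
Proof.
rewrite spectral_mapE -sum_orth_proj; apply: eq_bigr => l _.
by rewrite rmorph1 scale1r.
Qed.

Lemma spectral_map_id : spectral_map id M = M.
Proof.
rewrite spectral_mapE -[RHS]mul1mx -sum_orth_proj mulmx_suml.
by apply: eq_bigr => l _; rewrite mul_orth_proj_eigenspace.
Qed.

Lemma spectral_mapB (h g : R -> R) :
  spectral_map (fun l => h l - g l) M = spectral_map h M - spectral_map g M.
Proof.
rewrite !spectral_mapE -sumrB; apply: eq_bigr => l _.
by rewrite rmorphB scalerBl.
Qed.

Lemma spectral_map_adj (h : R -> R) : adjmx (spectral_map h M) = spectral_map h M.
Proof.
rewrite !spectral_mapE /adjmx !raddf_sum /=; apply: eq_bigr => l _.
by rewrite -/(adjmx _) adjmxZ orth_proj_adj.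
Qed.

(** Pythagoras: [h(M)] is self-adjoint, so the squared norm is the quadratic form of
    [h(M) *m h(M)]. *)
Lemma sqnorm_spectral_map (h : R -> R) (w : 'cV[K]_n) :
  sqnorm (spectral_map h M *m w) = \sum_(l : spec) h (val l) ^+ 2 * sqnorm (P l *m w).
Proof.
apply: (can_inj (@of_realK R k)).
rewrite sqnormE adjmxM spectral_map_adj mulmxA -(mulmxA (adjmx w)) spectral_mapM.
rewrite spectral_mapE rmorph_sum mulmx_sumr mulmx_suml summxE.
apply: eq_bigr => l _; rewrite rmorphM /= sqnormE adjmxM orth_proj_adj.
by rewrite mulmxA -[in RHS](mulmxA (adjmx w)) orth_proj_idem -scalemxAr -scalemxAl mxE.
Qed.

(** The preceding identity, for [h] and for the constant 1, compares both sides projection by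
    projection; this bounds the operator norm of [h(M)] by the values of [h] on the spectrum. *)
Lemma sqnorm_spectral_map_le (h : R -> R) (c : R) (w : 'cV[K]_n) :
  (forall l, eigenvalue M (of_real k l) -> h l ^+ 2 <= c) ->
  sqnorm (spectral_map h M *m w) <= c * sqnorm w.
Proof.
move=> hc; rewrite -{2}(mul1mx w) -spectral_map_1 !sqnorm_spectral_map mulr_sumr.
apply: ler_sum => l _; rewrite expr1n mul1r ler_wpM2r ?sqnorm_ge0//.
by apply: hc; rewrite -mem_spectrum; exact: valP.
Qed.

End HermitianSpectrum.

(** * Finite sums and square-summable sequences *)

Lemma cauchy_schwarz_sum (R : realFieldType) (I : Type) (r : seq I) (a b : I -> R) :
  (\sum_(i <- r) a i * b i) ^+ 2 <=
  (\sum_(i <- r) a i ^+ 2) * (\sum_(i <- r) b i ^+ 2).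
Proof.
elim: r => [|i r IHr]; first by rewrite !big_nil expr0n mul0r.
rewrite !big_cons; move: IHr.
have : 0 <= \sum_(j <- r) a j ^+ 2 by apply: sumr_ge0 => j _; exact: sqr_ge0.
have : 0 <= \sum_(j <- r) b j ^+ 2 by apply: sumr_ge0 => j _; exact: sqr_ge0.
set X := \sum_(j <- r) b j ^+ 2; set Y := \sum_(j <- r) a j ^+ 2.
set C := \sum_(j <- r) a j * b j; set s := a i; set t := b i => X0 Y0 CXY.
have D0 : 0 <= Y * t ^+ 2 + X * s ^+ 2 by apply: addr_ge0; apply: mulr_ge0; rewrite ?sqr_ge0.
have : C * s * t *+ 2 <= Y * t ^+ 2 + X * s ^+ 2.
  apply: le_trans (ler_norm _) _; rewrite -ler_sqr ?nnegrE//.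
  rewrite real_normK ?num_real// -subr_ge0.
  (* AM-GM with an explicit remainder, nonnegative by the induction hypothesis [CXY]. *)
  have -> : (Y * t ^+ 2 + X * s ^+ 2) ^+ 2 - (C * s * t *+ 2) ^+ 2 =
    (Y * t ^+ 2 - X * s ^+ 2) ^+ 2 + 4 * (s * t) ^+ 2 * (Y * X - C ^+ 2) by ring.
  by rewrite addr_ge0 ?sqr_ge0// mulr_ge0 ?subr_ge0// mulr_ge0 ?sqr_ge0.
nra.
Qed.

Section SquareSummable.
Context (R : realType) (k : scalar_kind).
Local Notation K := (base_field R k).
Implicit Types a b : nat -> K.

(** Finite windows of the squared norm: [ell2] estimates become real inequalities on them, and tails
    are windows too. *)
Definition sqsum a (m n : nat) : R := \sum_(m <= i < n) rnorm (a i) ^+ 2.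

Lemma sqsum_ge0 a m n : 0 <= sqsum a m n.
Proof. by apply: sumr_ge0 => i _; exact: sqr_ge0. Qed.

Lemma sqsum_cat a m n p : (m <= n <= p)%N -> sqsum a m p = sqsum a m n + sqsum a n p.
Proof. by case/andP => mn np; rewrite /sqsum (big_cat_nat mn np). Qed.

Lemma sqsum_le a m n p : (n <= p)%N -> sqsum a m n <= sqsum a m p.
Proof.
move=> np; have [mn|nm] := leqP m n.
  by rewrite (@sqsum_cat _ m n p) ?mn// lerDl sqsum_ge0.
by rewrite /sqsum (big_geq (ltnW nm)) sqsum_ge0.
Qed.

Lemma sqsum_nneseries_le a N :
  ((sqsum a 0 N)%:E <= \sum_(0 <= i <oo) (rnorm (a i) ^+ 2)%:E)%E.
Proof.
rewrite -sumEFin; apply: nneseries_lim_ge => i _ _.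
by rewrite lee_fin sqr_ge0.
Qed.

Lemma nneseries_sqsum_le a (C : R) : (forall N, sqsum a 0 N <= C) ->
  (\sum_(0 <= i <oo) (rnorm (a i) ^+ 2)%:E <= C%:E)%E.
Proof.
move=> aC; apply: lime_le.
  by apply: is_cvg_nneseries => i _ _; rewrite lee_fin sqr_ge0.
by apply: nearW => N; rewrite sumEFin lee_fin; exact: aC.
Qed.

Lemma ell2_norm_le a (C : R) : 0 <= C -> (forall N, sqsum a 0 N <= C ^+ 2) ->
  (ell2_norm a <= C%:E)%E.
Proof.
move=> C0 /nneseries_sqsum_le aC.
have a0 : (0 <= \sum_(0 <= i <oo) (rnorm (a i) ^+ 2)%:E)%E.
  by apply: nneseries_ge0 => i _ _; rewrite lee_fin sqr_ge0.
apply: (@le_trans _ _ ((C ^+ 2)%:E `^ 2^-1)%E); last first.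
  by rewrite poweR_EFin lee_fin powR12_sqrt ?sqr_ge0// sqrtr_sqr ger0_norm.
apply: gt0_ler_poweR => //; rewrite in_itv/= leey andbT//.
by rewrite lee_fin sqr_ge0.
Qed.

Lemma ell2P a : ell2 a <-> exists C : R, forall N, sqsum a 0 N <= C.
Proof.
split=> [|[C aC]].
  rewrite /ell2 /ell2_norm => a_fin; move: (sqsum_nneseries_le a) a_fin.
  case: (\sum_(0 <= i <oo) _)%E => [C aC _|_|/(_ 0%N)//].
    by exists C => N; rewrite -lee_fin.
  by rewrite poweRyr ?invr_eq0 ?pnatr_eq0.
apply: le_lt_trans (ltry (Num.sqrt C)); apply: ell2_norm_le.
  exact: sqrtr_ge0.
by move=> N; rewrite sqr_sqrtr// (le_trans (sqsum_ge0 a 0 0)).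
Qed.

(** Partial sums increase to their supremum; once one is within [e] of it, any later window has sum
    at most [e]. *)
Lemma ell2_tail a (e : R) : ell2 a -> 0 < e ->
  exists N, forall m n, (N <= m)%N -> sqsum a m n <= e.
Proof.
move=> /ell2P[C aC] e0.
have supS : has_sup (range (sqsum a 0)).
  by split; [exists (sqsum a 0 0); exists 0%N|exists C => _ [N _ <-]].
have [_ [N _ <-] supN] := sup_adherent e0 supS.
exists N => m n Nm; have [mn|/ltnW nm] := leqP m n; last first.
  by rewrite /sqsum big_geq// ltW.
have : sqsum a 0 n <= sup (range (sqsum a 0)).
  by apply: ub_le_sup; [case: supS|exists n].
rewrite (@sqsum_cat a 0 m n) ?mn// => an.
have aNm : sqsum a 0 N <= sqsum a 0 m by exact: sqsum_le.
lra.
Qed.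

Lemma ell2B a b : ell2 a -> ell2 b -> ell2 (fun i => a i - b i).
Proof.
move=> /ell2P[C aC] /ell2P[C' bC']; apply/ell2P; exists (2 * C + 2 * C') => N.
apply: (@le_trans _ _ (2 * sqsum a 0 N + 2 * sqsum b 0 N)); last first.
  by rewrite lerD// ler_pM2l.
rewrite /sqsum !mulr_sumr -big_split /=; apply: ler_sum => i _.
have := rnormD (a i) (- b i); rewrite rnormN.
have := rnorm_ge0 (a i); have := rnorm_ge0 (b i); have := rnorm_ge0 (a i - b i).
have := sqr_ge0 (rnorm (a i) - rnorm (b i)).
nra.
Qed.

End SquareSummable.

(** * Inner product and Cauchy-Schwarz inequality *)

Section InnerProduct.
Context (R : realType) (k : scalar_kind).
Local Notation K := (base_field R k).
Context (H : completeNormedModType K) (dot : {dot H for @sconj R k}).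
Hypothesis dot_norm : forall x : H, `|x| ^+ 2 = dot x x.
Implicit Types x y z : H.

Lemma dotC x y : dot x y = sconj (dot y x).
Proof. by have := hermC dot x y; rewrite expr0 mul1r. Qed.

Lemma dotDl x y z : dot (x + y) z = dot x z + dot y z.
Proof. exact: linearDl. Qed.

Lemma dotBl x y z : dot (x - y) z = dot x z - dot y z.
Proof. exact: linearBl. Qed.

Lemma dotZl (c : K) x y : dot (c *: x) y = c * dot x y.
Proof. exact: linearZl_LR. Qed.

Lemma dotBr x y z : dot x (y - z) = dot x y - dot x z.
Proof. exact: linearBr. Qed.

Lemma dotZr (c : K) x y : dot x (c *: y) = sconj c * dot x y.
Proof. by rewrite dotC dotZl rmorphM /= -dotC. Qed.

Lemma dot_suml (I : Type) (r : seq I) (F : I -> H) y :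
  dot (\sum_(i <- r) F i) y = \sum_(i <- r) dot (F i) y.
Proof. exact: linear_sumlz. Qed.

Lemma dot_self x : dot x x = of_real k (rnorm x ^+ 2).
Proof. by rewrite -dot_norm rmorphXn /= of_real_rnorm. Qed.

Lemma rnorm_dotC x y : rnorm (dot x y) = rnorm (dot y x).
Proof. by rewrite dotC rnorm_sconj. Qed.

Lemma cauchy_schwarz x y : rnorm (dot x y) <= rnorm x * rnorm y.
Proof.
have [y0|y0] := eqVneq (rnorm y) 0.
  by rewrite y0 mulr0 (rnorm0_eq0 y0) linear0r rnorm0.
have y_gt0 : 0 < rnorm y by rewrite lt_def y0 rnorm_ge0.
(* [z] is [rnorm y ^+ 2] times the component of [x] orthogonal to [y], scaled to avoid a
   division. *)
pose c := dot x y; pose z := of_real k (rnorm y ^+ 2) *: x - c *: y.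
have zz : rnorm z ^+ 2 = rnorm y ^+ 2 * (rnorm y ^+ 2 * rnorm x ^+ 2 - rnorm c ^+ 2).
  apply: (can_inj (@of_realK R k)); rewrite -dot_self.
  rewrite /z dotBl !dotBr !dotZl !dotZr -/c (dotC y x) -/c !dot_self sconj_of_real.
  have : c * sconj c = of_real k (rnorm c ^+ 2) by exact: mul_sconj.
  move=> cc; rewrite [RHS]rmorphM [in RHS]rmorphB /= [in RHS]rmorphM /= -cc; ring.
rewrite -ler_sqr ?nnegrE ?mulr_ge0 ?rnorm_ge0// exprMn mulrC -subr_ge0 -/c.
by rewrite -(pmulr_rge0 _ (exprn_gt0 2 y_gt0)) -zz sqr_ge0.
Qed.

Lemma cvg_dotl (v : nat -> H) x y :
  v @ \oo --> x -> (fun n => rnorm (dot (v n) y - dot x y)) @ \oo --> 0.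
Proof.
move=> /cvg_rnorm vx.
apply: (@squeeze_cvgr _ _ _ _ (fun=> 0) (fun n => rnorm (v n - x) * rnorm y)).
- by apply: nearW => n; rewrite rnorm_ge0 -dotBl cauchy_schwarz.
- exact: cvg_cst.
- by rewrite -(mul0r (rnorm y)); apply: cvgMl.
Qed.

(** * Frame bounds, analysis and synthesis *)

Variables (A B : R) (u : nat -> H).
Hypothesis u_frame : is_frame dot A B u.

Local Notation T := (analysis_op dot u).
Local Notation D := (synthesis_op u).

Lemma frame_bounds_gt0 : 0 < A /\ 0 < B.
Proof. by have [A0 AB _] := u_frame; split=> //; exact: lt_le_trans AB. Qed.

Lemma frame_upper x N : sqsum (T x) 0 N <= B * rnorm x ^+ 2.
Proof.
have [_ _ /(_ x)/andP[_ xB]] := u_frame.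
by rewrite -lee_fin (le_trans (sqsum_nneseries_le _ _)).
Qed.

Lemma frame_lower x (C : R) : (forall N, sqsum (T x) 0 N <= C) ->
  A * rnorm x ^+ 2 <= C.
Proof.
move=> xC; have [_ _ /(_ x)/andP[xA _]] := u_frame.
by rewrite -lee_fin (le_trans xA)// nneseries_sqsum_le.
Qed.

Lemma ell2_analysis x : ell2 (T x).
Proof. by apply/ell2P; exists (B * rnorm x ^+ 2) => N; exact: frame_upper. Qed.

(** Duality: for the finite sum [s], [|s|^2] is the sum of [a i * <u i, s>], at most [|a| |T s|],
    and [|T s|^2 <= B |s|^2]; squaring and dividing by [|s|^2] concludes. *)
Lemma bessel_synthesis (a : nat -> K) m n :
  rnorm (\sum_(m <= i < n) a i *: u i) ^+ 2 <= B * sqsum a m n.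
Proof.
set s := \sum_(m <= i < n) a i *: u i.
have [s0|s0] := eqVneq (rnorm s) 0.
  by rewrite s0 expr0n mulr_ge0 ?sqsum_ge0// ltW// frame_bounds_gt0.2.
have ss : rnorm s ^+ 2 <= \sum_(m <= i < n) rnorm (a i) * rnorm (T s i).
  rewrite -(of_realK k (rnorm s ^+ 2)) -dot_self {1}/s dot_suml raddf_sum /=.
  apply: ler_sum => i _; rewrite (le_trans (sre_le_rnorm _))//.
  by rewrite dotZl rnormM rnorm_dotC.
have Ts : sqsum (T s) m n <= B * rnorm s ^+ 2.
  apply: le_trans (frame_upper s n); have [mn|/ltnW nm] := leqP m n.
    by rewrite (@sqsum_cat _ _ _ 0 m n) ?mn// lerDr sqsum_ge0.
  by rewrite /sqsum big_geq// sumr_ge0// => i _; exact: sqr_ge0.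
have s2 : 0 < rnorm s ^+ 2 by rewrite exprn_gt0// lt_def s0 rnorm_ge0.
rewrite -(ler_pM2r s2) -expr2.
apply: (@le_trans _ _ ((\sum_(m <= i < n) rnorm (a i) * rnorm (T s i)) ^+ 2)).
  by rewrite ler_sqr ?nnegrE ?(le_trans (ltW s2) ss)// ltW.
apply: (le_trans (cauchy_schwarz_sum _ _ _)).
by rewrite (mulrC B) -mulrA; apply: ler_wpM2l => //; exact: sqsum_ge0.
Qed.

Lemma cvg_synthesis a : ell2 a -> series (fun i => a i *: u i) @ \oo --> D a.
Proof.
move=> a2; suff [l al] : exists l : H, series (fun i => a i *: u i) @ \oo --> l.
  by rewrite /synthesis_op (cvg_lim _ al).
apply: cvg_of_cauchy => e e0; have B0 := frame_bounds_gt0.2.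
have [|N aN] := ell2_tail a2 (e := e ^+ 2 / B); first by rewrite divr_gt0 ?exprn_gt0.
exists N => m Nm; rewrite sub_series_geq//.
rewrite -ler_sqr ?nnegrE ?rnorm_ge0 ?(ltW e0)//.
by rewrite (le_trans (bessel_synthesis _ _ _))// mulrC -ler_pdivlMr// aN.
Qed.

Lemma synthesisB a b : ell2 a -> ell2 b -> D (fun i => a i - b i) = D a - D b.
Proof.
move=> a2 b2; apply: cvg_lim => //.
rewrite (_ : series _ = series (fun i => a i *: u i) - series (fun i => b i *: u i)).
  exact: cvgB (cvg_synthesis a2) (cvg_synthesis b2).
apply/funext => n; rewrite /series /= fctE /= -sumrB.
by apply: eq_bigr => i _; rewrite scalerBl.
Qed.

Lemma analysisB x y : T (x - y) = (fun i => T x i - T y i).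
Proof. by apply/funext => i; rewrite /analysis_op dotBl. Qed.

(** * Invertibility of the frame operator *)

Local Notation S x := (D (T x)).

Lemma frame_opB x y : S (x - y) = S x - S y.
Proof. by rewrite analysisB synthesisB//; exact: ell2_analysis. Qed.

Lemma frame_opZ (c : K) x : S (c *: x) = c *: S x.
Proof.
apply: cvg_lim => //.
rewrite (_ : series _ = fun n => c *: series (fun i => T x i *: u i) n).
  by apply: cvgZr; apply: cvg_synthesis; exact: ell2_analysis.
apply/funext => n; rewrite /series /= scaler_sumr.
by apply: eq_bigr => i _; rewrite /analysis_op dotZl scalerA.
Qed.

Lemma rnorm_subZ_sq x y (c : R) :
  rnorm (x - of_real k c *: y) ^+ 2 =
  rnorm x ^+ 2 - c * sre (dot y x) *+ 2 + c ^+ 2 * rnorm y ^+ 2.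
Proof.
rewrite -[LHS](of_realK k) -dot_self dotBl !dotBr !dotZl !dotZr sconj_of_real.
rewrite !raddfB /= !sre_of_realM !dot_self !of_realK (dotC x y) sre_conj.
ring.
Qed.

(** The partial sums of the series defining [S x], paired with [x], give exactly the partial sums of
    [|T x|^2], which increase to [<S x, x>]. *)
Lemma sqsum_analysis_le x N : sqsum (T x) 0 N <= sre (dot (S x) x).
Proof.
pose s := series (fun i => T x i *: u i).
have s_dot n : dot (s n) x = of_real k (sqsum (T x) 0 n).
  rewrite /s /series /= dot_suml rmorph_sum; apply: eq_bigr => i _.
  by rewrite dotZl dotC mul_sconj.
have sS := cvg_dotl x (cvg_synthesis (ell2_analysis x)).
apply/ler_addgt0Pr => e e0.
have [M _ MP] := cvgr_le 0 sS e e0.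
have MM : (M <= maxn M N)%N by exact: leq_maxl.
have {}MP := MP _ MM.
rewrite -lerBlDl; apply: le_trans MP; apply: le_trans (sre_le_rnorm _).
rewrite -/(s _) s_dot raddfB /= of_realK lerB// sqsum_le//.
exact: leq_maxr.
Qed.

Lemma frame_op_lower x : A * rnorm x ^+ 2 <= sre (dot (S x) x).
Proof. by apply: frame_lower => N; exact: sqsum_analysis_le. Qed.

(** The Bessel bound gives at most [B <S x, x>] for each partial sum, and this passes to the
    limit. *)
Lemma frame_op_upper x : rnorm (S x) ^+ 2 <= B * sre (dot (S x) x).
Proof.
have B0 := frame_bounds_gt0.2.
have q0 : 0 <= sre (dot (S x) x) by exact: le_trans (sqsum_ge0 _ 0 0) (sqsum_analysis_le x 0).
have Bq0 : 0 <= B * sre (dot (S x) x) by rewrite mulr_ge0// ltW.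
rewrite -[leRHS]sqr_sqrtr// ler_sqr ?nnegrE ?sqrtr_ge0 ?rnorm_ge0//.
apply: rnorm_lim_le (cvg_synthesis (ell2_analysis x)) _ => n.
rewrite -ler_sqr ?nnegrE ?sqrtr_ge0 ?rnorm_ge0// sqr_sqrtr//.
apply: le_trans (bessel_synthesis _ _ _) _.
by rewrite ler_wpM2l ?sqsum_analysis_le// ltW.
Qed.

Lemma frame_op_dot_le x : sre (dot (S x) x) <= rnorm (S x) * rnorm x.
Proof. exact: le_trans (sre_le_rnorm _) (cauchy_schwarz _ _). Qed.

Lemma frame_op_expanding x : A * rnorm x <= rnorm (S x).
Proof.
have [x0|x0] := eqVneq (rnorm x) 0; first by rewrite x0 mulr0 rnorm_ge0.
have x_gt0 : 0 < rnorm x by rewrite lt_def x0 rnorm_ge0.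
rewrite -(ler_pM2r x_gt0) -mulrA -expr2.
exact: le_trans (frame_op_lower x) (frame_op_dot_le x).
Qed.

Lemma frame_op_bounded x : rnorm (S x) <= B * rnorm x.
Proof.
have [x0|x0] := eqVneq (rnorm (S x)) 0.
  by rewrite x0 mulr_ge0 ?rnorm_ge0// ltW// frame_bounds_gt0.2.
have x_gt0 : 0 < rnorm (S x) by rewrite lt_def x0 rnorm_ge0.
rewrite -(ler_pM2r x_gt0) -expr2 -mulrA (le_trans (frame_op_upper x))//.
by rewrite ler_pM2l ?frame_bounds_gt0.2// mulrC frame_op_dot_le.
Qed.

Lemma frame_opD x y : S (x + y) = S x + S y.
Proof.
have SN : S (- y) = - S y by rewrite -scaleN1r frame_opZ scaleN1r.
by rewrite -{1}(opprK y) frame_opB SN opprK.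
Qed.

(** With [q] the real part of [<S x, x>], the square expands to [|x|^2 - 2 q / B + |S x|^2 / B^2].
    The bound [|S x|^2 <= B q] leaves at most [|x|^2 - q / B], and [q >= A |x|^2]. *)
Lemma frame_op_contraction x :
  rnorm (x - of_real k B^-1 *: S x) ^+ 2 <= (1 - A / B) * rnorm x ^+ 2.
Proof.
have B0 := frame_bounds_gt0.2.
rewrite rnorm_subZ_sq; set q := sre _.
have : B^-1 ^+ 2 * rnorm (S x) ^+ 2 <= B^-1 * q.
  rewrite expr2 -mulrA ler_pM2l ?invr_gt0// mulrC ler_pdivrMr// mulrC.
  exact: frame_op_upper.
have : A / B * rnorm x ^+ 2 <= B^-1 * q.
  rewrite mulrAC mulrC ler_pM2l ?invr_gt0//; exact: frame_op_lower.
lra.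
Qed.

(* Richardson iteration: the residuals [x - S y_n] decay geometrically, and    *)
(* [S] is bounded below, so that the iterates [y_n] are Cauchy.                *)
Lemma frame_op_surj x : exists y, S y = x.
Proof.
have [A0 B0] := frame_bounds_gt0.
have AB : A <= B by case: u_frame.
pose r := fix r n := if n is m.+1 then r m - of_real k B^-1 *: S (r m) else x.
pose y n := \sum_(0 <= i < n) of_real k B^-1 *: r i.
have Sy n : S (y n) = x - r n.
  elim: n => [|n IHn].
    rewrite /y big_nil /= subrr.
    by have := frame_opZ 0 0; rewrite !scale0r.
  rewrite /y big_nat_recr//= frame_opD -/(y n) IHn frame_opZ opprB.
  by rewrite addrA addrAC.
have rn n : rnorm (r n) ^+ 2 <= (1 - A / B) ^+ n * rnorm x ^+ 2.
  elim: n => [|n IHn]; first by rewrite expr0 mul1r.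
  apply: (le_trans (frame_op_contraction _)); rewrite (exprS _ n) -mulrA.
  by rewrite ler_wpM2l// subr_ge0 ler_pdivrMr// mul1r.
have r0 (e : R) : 0 < e -> exists N, forall n, (N <= n)%N -> rnorm (r n) <= e.
  move=> e0.
  have : (fun n => (1 - A / B) ^+ n * rnorm x ^+ 2) @ \oo --> 0.
    rewrite -(mul0r (rnorm x ^+ 2)); apply: cvgMl; apply: cvg_expr.
    rewrite ger0_norm ?subr_ge0 ?ler_pdivrMr// ?mul1r// gtrBl.
    by rewrite divr_gt0.
  move=> /cvgr_le/(_ (e ^+ 2) (exprn_gt0 2 e0))[N _ NP].
  exists N => n Nn; rewrite -ler_sqr ?nnegrE ?rnorm_ge0 ?(ltW e0)//.
  exact: le_trans (rn n) (NP n Nn).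
have [l yl] : exists l : H, y @ \oo --> l.
  apply: cvg_of_cauchy => e e0.
  (* [A |y m - y N| <= |r m| + |r N|], whence the tolerance [A * e / 2]. *)
  have [|N NP] := r0 (A * e / 2); first by rewrite divr_gt0 ?mulr_gt0.
  exists N => m Nm; rewrite -(ler_pM2l A0) (le_trans (frame_op_expanding _))//.
  rewrite frame_opB !Sy opprB addrC addrA subrK.
  rewrite (le_trans (rnormD _ _))// rnormN.
  by have := NP _ (leqnn N); have := NP _ Nm; lra.
exists l; apply/eqP; rewrite -subr_eq0; apply/eqP/rnorm0_eq0/eqP.
rewrite eq_le rnorm_ge0 andbT; apply/ler_addgt0Pr => e e0; rewrite add0r.
have [|N NP] := r0 (e / 2); first by rewrite divr_gt0.
have yl0 := (cvg_rnorm y l).1 yl.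
have [|M _ MP] := cvgr_le 0 yl0 (e / 2 / B); first by rewrite !divr_gt0.
pose n := maxn M N.
have -> : S l - x = S (l - y n) - r n.
  by rewrite frame_opB Sy opprB addrA addrAC addrK.
rewrite (le_trans (rnormD _ _))// rnormN (splitr e) lerD ?NP ?leq_maxr//.
rewrite (le_trans (frame_op_bounded _))// mulrC -ler_pdivlMr// rnormB.
by apply: MP; exact: leq_maxl.
Qed.

(** * Canonical coefficients as a pseudo-inverse image *)

Implicit Types a b w : nat -> K.

(** The adjoint relation [<T y, w> = <y, D w>], as convergence of partial sums. *)
Lemma cvg_dot_synthesis y w : ell2 w ->
  (fun N => rnorm (\sum_(0 <= i < N) T y i * sconj (w i) - dot y (D w)))
    @ \oo --> 0.
Proof.
move=> /cvg_synthesis/(cvg_dotl y).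
set s := series _; set f := (fun N => _); set g := (fun N => _).
suff -> : f = g by [].
apply/funext => N; rewrite /f /g (dotC y) -rnorm_sconj rmorphB /= sconjK.
congr (rnorm (_ - _)); rewrite /s /series /= dot_suml rmorph_sum.
by apply: eq_bigr => i _; rewrite rmorphM /= sconjK dotZl mulrC /analysis_op -dotC.
Qed.

Lemma ell2_dot_eq a b (l : K) :
  (fun N => rnorm (\sum_(0 <= i < N) a i * sconj (b i) - l)) @ \oo --> 0 ->
  ell2_dot a b = l.
Proof.
move=> abl; apply: cvg_lim => //.
exact: (@cvg_rnorm R k K^o (series (fun i => a i * sconj (b i))) l).2.
Qed.

Lemma analysis_inj x : T x = cst 0 -> x = 0.
Proof.
move=> Tx0; apply: rnorm0_eq0; apply/eqP; rewrite -sqrf_eq0 eq_le sqr_ge0 andbT.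
rewrite -(ler_pM2l frame_bounds_gt0.1) mulr0; apply: frame_lower => N.
by rewrite Tx0 /sqsum big1// => i _; rewrite rnorm0 expr0n.
Qed.

(** [T y] meets the defining conditions of the pseudo-inverse. They determine it: for another
    solution [z], the difference [d] lies in the kernel of [D], to which both [z] and [T y] are
    orthogonal, so [<d, d> = 0]. *)
Lemma canonical_coefE x y : S y = x -> canonical_coef dot u x = T y.
Proof.
move=> Sy; have Ty := ell2_analysis y.
have pinv_y : is_pinv (gram_op dot u) (T x) (T y).
  (* As [T] is injective, the kernel of the Gram operator is that of [D], and the range of [T] is
     orthogonal to it. *)
  split=> // [w w2 /analysis_inj Dw|].
    have := cvg_dot_synthesis y w2; rewrite Dw linear0r; exact: ell2_dot_eq.
  exists (cst 0); split.
  - by apply/ell2P; exists 0 => N; rewrite /sqsum big1// => i _; rewrite rnorm0 expr0n.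
  - apply/funext => i; rewrite /gram_op /analysis_op.
    have := synthesisB Ty Ty; rewrite subrr (_ : (fun _ => _) = cst 0).
      by move=> ->; rewrite linear0l.
    by apply/funext => j; rewrite subrr.
  - by apply/funext => i; rewrite addr0 /gram_op Sy.
have : is_pinv (gram_op dot u) (T x) (canonical_coef dot u x).
  by apply: (@xgetPex _ (cst 0) (is_pinv (gram_op dot u) (T x))); exists (T y).
move: (canonical_coef dot u x) => z [z2 z_orth [w [w2 Gw Tx]]].
(* The kernel component [w] of [T x] lies in the range of [T]; then [S (x - D z) = D w = 0] forces
   [x = D z]. *)
have wT : w = T (x - D z).
  by rewrite analysisB Tx; apply/funext => i; rewrite /gram_op addrC addKr.
have Dz : x - D z = 0.
  apply: rnorm0_eq0; apply/eqP; rewrite eq_le rnorm_ge0 andbT.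
  rewrite -(ler_pM2l frame_bounds_gt0.1) mulr0.
  by rewrite (le_trans (frame_op_expanding _))// -wT (analysis_inj Gw) rnorm0.
pose d i := z i - T y i.
have d2 : ell2 d by exact: ell2B.
have Dd : D d = 0 by rewrite synthesisB// Sy; apply/eqP; rewrite -oppr_eq0 opprB Dz.
have zd : ell2_dot z d = 0.
  by apply: z_orth => //; apply/funext => i; rewrite /gram_op Dd /analysis_op linear0l.
have [C dC] := (ell2P d).1 d2.
have d_nd : nondecreasing_seq (sqsum d 0) by move=> m n; exact: sqsum_le.
have d_ub : has_ubound (range (sqsum d 0)) by exists C => _ [N _ <-].
have d_cvg := nondecreasing_cvgn d_nd d_ub.
set l := sup _ in d_cvg.
(* [<z, d> = <d, d> + <T y, d>], where [<d, d>] is the supremum [l] and the second term is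
   [<y, D d> = 0]. *)
have zd_l : ell2_dot z d = of_real k l.
  apply: ell2_dot_eq.
  have dl0 : (fun N => `|sqsum d 0 N - l|) @ \oo --> 0.
    by apply/norm_cvg0P; rewrite -(subrr l); apply: cvgB => //; exact: cvg_cst.
  apply: (@squeeze_cvgr _ _ _ _ (fun=> 0) (fun N => `|sqsum d 0 N - l| +
      rnorm (\sum_(0 <= i < N) T y i * sconj (d i) - dot y (D d)))).
  - apply: nearW => N.
    rewrite rnorm_ge0 /= -(rnorm_of_real k) raddfB /= Dd linear0r subr0.
    apply: le_trans (rnormD _ _); rewrite le_eqVlt; apply/orP; left; apply/eqP.
    congr rnorm; rewrite addrAC; congr (_ - _).
    rewrite rmorph_sum -big_split /=; apply: eq_bigr => i _.
    by rewrite -mul_sconj -mulrDl subrK.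
  - exact: cvg_cst.
  - by rewrite -(addr0 (0 : R)); apply: cvgD => //; exact: cvg_dot_synthesis.
have l0 : l = 0 by apply: (can_inj (@of_realK R k)); rewrite -zd_l zd rmorph0.
apply/funext => i; apply/eqP; rewrite -subr_eq0; apply/eqP/rnorm0_eq0/eqP.
rewrite -sqrf_eq0 eq_le sqr_ge0 andbT -l0.
apply: (@le_trans _ _ (sqsum d 0 i.+1)).
  by rewrite /sqsum big_nat_recr//= lerDr sumr_ge0// => j _; exact: sqr_ge0.
by apply: ub_le_sup => //; exists i.+1.
Qed.

(** * Finite sections of the Gram operator and their spectrum *)

Lemma mul_gram_section n a i :
  (gram_section dot u n *m \col_(j < n) a j) i 0 =
  dot (\sum_(0 <= j < n) a j *: u j) (u i).
Proof.
rewrite dot_suml big_mkord mxE; apply: eq_bigr => j _.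
by rewrite !mxE dotZl mulrC.
Qed.

Lemma gram_section_adj n : adjmx (gram_section dot u n) = gram_section dot u n.
Proof. by apply/matrixP => i j; rewrite !mxE -dotC. Qed.

(** For a row eigenvector [v] with conjugate coefficients [c], the quadratic form equals [|s|^2],
    where [s] is the combination of the [u j], and also [l] times the positive [|v|^2]. *)
Lemma gram_section_eigenvalue_ge0 n (l : R) :
  eigenvalue (gram_section dot u n) (of_real k l) -> 0 <= l.
Proof.
move=> /eigenvalueP[v vM v0].
(* Coefficients indexed by [nat]; the default 0 is never read, as [s] uses indices below [n]. *)
pose c (j : nat) : K := if insub j is Some j' then sconj (v 0 j') else 0.
have cE (j : 'I_n) : c j = sconj (v 0 j) by rewrite /c valK.
pose s := \sum_(0 <= j < n) c j *: u j.
have : (v *m (gram_section dot u n *m \col_(j < n) c j)) 0 0 =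
    of_real k (rnorm s ^+ 2).
  rewrite -dot_self [in RHS]/s [in RHS]dotC dot_suml big_mkord rmorph_sum mxE.
  apply: eq_bigr => j _; rewrite mul_gram_section -/s dotZl cE rmorphM /= sconjK.
  by rewrite -dotC.
rewrite mulmxA vM -scalemxAl mxE.
have -> : \col_(j < n) c j = adjmx v by apply/matrixP => i j; rewrite !mxE cE ord1.
rewrite mulmx_adj_diag -rmorphM => /(can_inj (@of_realK R k)) ls.
have v_ge0 : 0 <= \sum_j rnorm (v 0 j) ^+ 2 by apply: sumr_ge0 => j _; exact: sqr_ge0.
have v_gt0 : 0 < \sum_j rnorm (v 0 j) ^+ 2.
  rewrite lt_def v_ge0 andbT; apply: contra_neq v0 => s0; apply: mulmx_adj_eq0.
  by apply/matrixP => i j; rewrite !ord1 mulmx_adj_diag s0 rmorph0 mxE.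
by rewrite -(pmulr_lge0 _ v_gt0) ls sqr_ge0.
Qed.

(** Otherwise eigenvalues in [[delta, eps]] occur for arbitrarily large sections; a convergent
    subsequence has its limit in [[delta, eps]], inside the gap [(0, A)], which is spectral
    pollution. *)
Lemma gram_section_gap (eps delta : R) : no_spectral_pollution dot A u ->
  0 < delta -> eps < A -> exists N, forall n (l : R), (N <= n)%N ->
    eigenvalue (gram_section dot u n) (of_real k l) -> l <= eps -> l < delta.
Proof.
move=> u_gap delta0 epsA; apply: contrapT => noN.
have /choice[f fP] : forall N, exists nl : nat * R, [/\ (N <= nl.1)%N,
    eigenvalue (gram_section dot u nl.1) (of_real k nl.2) & delta <= nl.2 <= eps].
  move=> N; apply: contrapT => noNl; apply: noN; exists N => n l Nn nl leps.
  rewrite ltNge; apply/negP => dl; apply: noNl; exists (n, l).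
  by split=> //; rewrite dl.
(* [p i] is a section size with its eigenvalue; each search starts beyond the preceding size, and
   [q i] is that starting point. *)
pose p := fix p i := f (if i is j.+1 then (p j).1.+1 else 0%N).
pose q i := if i is j.+1 then (p j).1.+1 else 0%N.
have pE i : p i = f (q i) by case: i.
have p_eig i : eigenvalue (gram_section dot u (p i).1) (of_real k (p i).2).
  by rewrite pE; have [] := fP (q i).
have p_bnd i : delta <= (p i).2 <= eps by rewrite pE; have [] := fP (q i).
have p_incr : {homo (fun i => (p i).1) : i j / (i < j)%N}.
  by apply: homo_ltn => [|i]; [exact: ltn_trans|have [] := fP (p i).1.+1].
have [|g g_incr l_cvg] := @bolzano_weierstrass R (fun i => (p i).2).
  exists (Num.max `|eps| `|delta|); split; first exact: num_real.
  move=> M ltM i _ /=; apply: le_trans (ltW ltM).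
  have /andP[d1 d2] := p_bnd i.
  rewrite ger0_norm ?(le_trans (ltW delta0))// le_max.
  by rewrite (le_trans d2) ?ler_norm.
apply: u_gap; exists (limn (fun i => (p (g i)).2)), (fun i => (p (g i)).1),
  (fun i => (p (g i)).2); split=> //.
  apply/andP; split.
    apply: (lt_le_trans delta0); apply: limr_ge => //.
    by apply: nearW => i; have /andP[] := p_bnd (g i).
  apply: le_lt_trans epsA; apply: limr_le => //.
  by apply: nearW => i; have /andP[] := p_bnd (g i).
move=> i j ij; apply: p_incr; rewrite ltnNge; apply/negP.
have := g_incr j i; rewrite !leEnat => ->.
by rewrite leqNgt ij.
Qed.

(** * Error estimate for the regularized sections *)

Local Notation col a n := (\col_(i < n) (a : nat -> K) i).

Lemma sqnorm_col n a : sqnorm (col a n) = sqsum a 0 n.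
Proof. by rewrite /sqsum big_mkord; apply: eq_bigr => i _; rewrite mxE. Qed.

Lemma sqnormB_le n (v w : 'cV[K]_n) : sqnorm (v - w) <= 2 * sqnorm v + 2 * sqnorm w.
Proof.
rewrite /sqnorm !mulr_sumr -big_split /=; apply: ler_sum => i _; rewrite !mxE.
have := rnormD (v i 0) (- w i 0); rewrite rnormN.
have := rnorm_ge0 (v i 0); have := rnorm_ge0 (w i 0).
have := rnorm_ge0 (v i 0 - w i 0); have := sqr_ge0 (rnorm (v i 0) - rnorm (w i 0)).
nra.
Qed.

Lemma analysis_split x a n : col (T x) n = gram_section dot u n *m col a n +
  col (T (x - \sum_(0 <= j < n) a j *: u j)) n.
Proof.
apply/matrixP => i j; rewrite ord1 [in RHS]mxE mul_gram_section !mxE.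
by rewrite /analysis_op -dotDl addrC subrK.
Qed.

(** The first three terms bound the parts [h(M) e], [(1 - h(M) M) M b_n] and [(1 - h(M) M) e']; the
    factors 2, 4, 4 come from splitting a sum of three in two steps. The last term is the part of
    [T y] that the section of size [n] cannot see. *)
Lemma section_error x y z (eps delta : R) n : 0 < eps -> 0 < delta ->
  S y = x -> S z = y ->
  (forall l, eigenvalue (gram_section dot u n) (of_real k l) -> l <= eps -> l < delta) ->
  forall N, sqsum (fun i => section_coef dot eps u x n i - T y i) 0 N <=
    2 * eps^-2 * B * rnorm (x - \sum_(0 <= j < n) T y j *: u j) ^+ 2 +
    4 * delta ^+ 2 * (B * rnorm z ^+ 2) +
    4 * B * rnorm (y - \sum_(0 <= j < n) T z j *: u j) ^+ 2 +
    sqsum (T y) n (maxn N n).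
Proof.
move=> eps0 delta0 Sy Sz gap N.
set M := gram_section dot u n; have M_herm : adjmx M = M := gram_section_adj n.
set e := x - _; set e' := y - _; set d := fun i => _.
(* From index [n] on, the extended vector is 0, so the error there is [- T y]. *)
have -> : forall C, sqsum d 0 N <= C + sqsum (T y) n (maxn N n) =
    (sqsum d 0 N <= C + sqsum d n (maxn N n)).
  move=> C; congr (_ <= _ + _); rewrite /sqsum !big_nat.
  apply: eq_bigr => i /andP[ni _]; rewrite /d /section_coef /extend0 insubF.
    by rewrite sub0r rnormN.
  by rewrite ltnNge ni.
apply: le_trans (sqsum_le d 0 (leq_maxl N n)) _.
rewrite (@sqsum_cat _ _ d 0 n) ?leq_maxr// lerD2r.
pose h := threshold_inv eps; pose hM := spectral_map h M.
(* [g] is 0 above [eps] and 1 elsewhere. *)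
pose g (l : R) := 1 - h l * l.
have gE : spectral_map g M = 1%:M - hM *m M.
  rewrite (spectral_mapB M (fun=> 1) (fun l => h l * l)) spectral_map_1//.
  by rewrite -(spectral_mapM M_herm h id) spectral_map_id.
have gME : spectral_map (fun l => g l * l) M = spectral_map g M *m M.
  by rewrite -(spectral_mapM M_herm g id) spectral_map_id.
have dE : col d n = hM *m col (T e) n -
    (spectral_map (fun l => g l * l) M *m col (T z) n + spectral_map g M *m col (T e') n).
  rewrite gME -mulmxA -mulmxDr -(analysis_split y) gE mulmxBl mul1mx -mulmxA.
  rewrite opprB addrA -mulmxDr addrC [_ + M *m _]addrC -(analysis_split x).
  apply/matrixP => i j; rewrite ord1 !mxE /d /section_coef /extend0 valK addrC.
  by congr (_ - _); rewrite mxE.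
have gle l : g l ^+ 2 <= 1.
  rewrite /g /h /threshold_inv; case: ifPn => [el|_].
    by rewrite mulVf ?subrr ?expr0n ?gt_eqF// (lt_trans eps0).
  by rewrite mul0r subr0 expr1n.
(* Up to [eps] the value [g l * l] is [l], an eigenvalue that is nonnegative and, by the gap, below
   [delta]; above [eps] it is 0. *)
have gl_le l : eigenvalue M (of_real k l) -> (g l * l) ^+ 2 <= delta ^+ 2.
  move=> Ml; have l0 := gram_section_eigenvalue_ge0 Ml.
  rewrite /g /h /threshold_inv; case: ifPn => [el|].
    by rewrite mulVf ?subrr ?mul0r ?expr0n ?sqr_ge0// gt_eqF// (lt_trans eps0).
  rewrite -leNgt mul0r subr0 mul1r => le_eps.
  by rewrite ler_sqr ?nnegrE// ?(ltW delta0)// ltW// gap.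
have hle l : h l ^+ 2 <= eps^-2.
  rewrite /h /threshold_inv; case: ifPn => [el|_].
    by rewrite exprVn lef_pV2 ?posrE ?exprn_gt0// ?(lt_trans eps0)// ler_sqr
      ?nnegrE ltW// (lt_trans eps0).
  by rewrite expr0n invr_ge0 sqr_ge0.
rewrite -sqnorm_col dE; apply: le_trans (sqnormB_le _ _) _.
have := sqnormB_le (spectral_map (fun l => g l * l) M *m col (T z) n)
  (- (spectral_map g M *m col (T e') n)); rewrite opprK.
have -> : sqnorm (- (spectral_map g M *m col (T e') n)) =
    sqnorm (spectral_map g M *m col (T e') n).
  by apply: eq_bigr => i _; rewrite mxE rnormN.
have := sqnorm_spectral_map_le M_herm (col (T e) n) (fun l _ => hle l).
have := sqnorm_spectral_map_le M_herm (col (T z) n) gl_le.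
have := sqnorm_spectral_map_le M_herm (col (T e') n) (fun l _ => gle l).
rewrite -/hM !sqnorm_col; have := frame_upper e n; have := frame_upper e' n.
have := frame_upper z n.
have := sqr_ge0 delta; have : 0 <= eps^-2 by rewrite invr_ge0 sqr_ge0.
set X := rnorm e ^+ 2; set Y := rnorm e' ^+ 2; set Z := rnorm z ^+ 2.
move: (sqsum _ _ _) (sqsum _ _ _) (sqsum _ _ _) => a1 a2 a3.
move: (sqnorm _) (sqnorm _) (sqnorm _) (sqnorm _) => b1 b2 b3 b4.
move: (eps^-2) (delta ^+ 2) => E F E0 F0 h1 h2 h3 h4 h5 h6 h7.
have h8 := ler_wpM2l E0 h3; have h9 := ler_wpM2l F0 h1.
lra.
Qed.

Lemma synthesis_remainder_cvg0 a (c e : R) : ell2 a -> 0 < e ->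
  exists N, forall n, (N <= n)%N ->
    c * rnorm (D a - \sum_(0 <= j < n) a j *: u j) ^+ 2 <= e.
Proof.
move=> /cvg_synthesis/cvg_rnorm a0 e0.
have : (fun n => c * (rnorm (series (fun i => a i *: u i) n - D a) *
                      rnorm (series (fun i => a i *: u i) n - D a))) @ \oo --> 0.
  by rewrite -(mulr0 c) -(mulr0 (0 : R)); apply: cvgMr; exact: cvgM.
move=> /cvgr_le/(_ e e0)[N _ NP]; exists N => n Nn.
by rewrite rnormB; exact: NP.
Qed.

End InnerProduct.

(** * Convergence of the regularized coefficients *)

Theorem theorem4p18 (R : realType) (k : scalar_kind)
    (H : completeNormedModType (base_field R k)) (dot : {dot H for @sconj R k})
    (dot_norm : forall x : H, `|x| ^+ 2 = dot x x)
    (A B : R) (u : nat -> H)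
    (u_frame : is_frame dot A B u)
    (u_gap : no_spectral_pollution dot A u)
    (eps : R) (eps_bound : 0 < eps < A) (x : H) :
  (fun n => ell2_norm (fun i => section_coef dot eps u x n i
                                - canonical_coef dot u x i)) @ \oo --> 0%E.
Proof.
have /andP[eps0 epsA] := eps_bound.
have [A0 B0] := frame_bounds_gt0 u_frame.
have [y Sy] := frame_op_surj dot_norm u_frame x.
have [z Sz] := frame_op_surj dot_norm u_frame y.
rewrite (canonical_coefE dot_norm u_frame Sy).
pose d n i := section_coef dot eps u x n i - analysis_op dot u y i.
rewrite -[X in X @ _]/(fun n => ell2_norm (d n)).
have d_le (e : R) : 0 < e -> \forall n \near \oo, (ell2_norm (d n) <= e%:E)%E.
  (* Each of the four terms of the error estimate gets [e ^+ 2 / 4]. *)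
  move=> e0; have e4 : 0 < e ^+ 2 / 4 by rewrite divr_gt0 ?exprn_gt0.
  have C0 : 0 <= B * rnorm z ^+ 2 by rewrite mulr_ge0 ?sqr_ge0 ?ltW.
  (* Chosen so that [4 * delta ^+ 2 * (B * rnorm z ^+ 2)] is at most [e ^+ 2 / 4]; the added 1 keeps
     the denominator positive when [z = 0]. *)
  pose delta := e / (4 * Num.sqrt (B * rnorm z ^+ 2 + 1)).
  have C1 : 0 < B * rnorm z ^+ 2 + 1 by rewrite ltr_wpDl.
  have delta0 : 0 < delta by rewrite divr_gt0// mulr_gt0// sqrtr_gt0.
  have delta_le : 4 * delta ^+ 2 * (B * rnorm z ^+ 2) <= e ^+ 2 / 4.
    rewrite /delta expr_div_n exprMn sqr_sqrtr ?(ltW C1)//.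
    set C := B * _ in C1 *.
    have -> : 4 * (e ^+ 2 / (4 ^+ 2 * (C + 1))) * C = e ^+ 2 / 4 * (C / (C + 1)).
      by field; rewrite gt_eqF.
    by rewrite ler_piMr ?(ltW e4)// ler_pdivrMr// mul1r lerDl.
  have [N1 gap] := gram_section_gap u_gap delta0 epsA.
  have y2 := ell2_analysis u_frame y; have z2 := ell2_analysis u_frame z.
  have [N2 xN] := synthesis_remainder_cvg0 dot_norm u_frame (2 * eps^-2 * B) y2 e4.
  have [N3 yN] := synthesis_remainder_cvg0 dot_norm u_frame (4 * B) z2 e4.
  have [N4 tailN] := ell2_tail y2 e4.
  exists (maxn (maxn N1 N2) (maxn N3 N4)) => // n /=.
  rewrite !geq_max => /andP[/andP[n1 n2] /andP[n3 n4]].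
  apply: ell2_norm_le => [|N]; first exact: ltW.
  have := section_error dot_norm u_frame eps0 delta0 Sy Sz (fun l => gap n l n1) N.
  have := xN n n2; have := yN n n3; have := tailN n (maxn N n) n4.
  rewrite Sy Sz; lra.
have d_ge0 n : (0 <= ell2_norm (d n))%E by exact: poweR_ge0.
(* Convergence in the extended reals: the norms are eventually finite, and their real values tend to
   0. *)
apply/fine_cvgP; split.
  have := d_le 1 ltr01; apply: filterS => n dn.
  by rewrite ge0_fin_numE// (le_lt_trans dn) ?ltry.
apply/cvgrPdist_le => e e0; have := d_le e e0; apply: filterS => n dn.
rewrite sub0r normrN ger0_norm ?fine_ge0//.
by rewrite -lee_fin fineK// ge0_fin_numE// (le_lt_trans dn) ?ltry.
Qed.
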